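(* Let $A\in\mathbb{R}^{n\times n}$ be symmetric and $B\in\mathbb{R}^{n\times n}$ symmetric positive definite, and let $u\in\mathbb{R}^n$ satisfy $u^TABu\ne0$. The generalized homogeneous Rayleigh quotient $\alpha$ of $(A,B)$ at $u$ is the solution to $$(u^TABu)\,\alpha^2+(u^TB^2u-u^TA^2u)\,\alpha-(u^TABu)=0$$ which satisfies $\alpha\cdot u^TABu>0$.
   Context: $\|\cdot\|$ is the Euclidean norm. For $u^TABu\neq0$ the generalized homogeneous Rayleigh quotient of $(A,B)$ at $u$ is $\alpha=\alpha_1/\alpha_2$, where $(\alpha_1,\alpha_2)$ is the unique minimizer of $\frac{\|\alpha_1Bu-\alpha_2Au\|}{\sqrt{\alpha_1^2+\alpha_2^2}}$ over the real projective line ($\mathbb{R}^2\setminus\{0\}$ modulo nonzero scalars); explicitly $$\alpha=\frac{1}{2\,u^TABu}\Big[u^TA^2u-u^TB^2u+\sqrt{(u^TA^2u-u^TB^2u)^2+4(u^TABu)^2}\Big].$$ *)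

(* Defs.v *)
From mathcomp Require Export all_boot all_order all_algebra.
From mathcomp Require Export reals.

Set Implicit Arguments.
Unset Strict Implicit.
Unset Printing Implicit Defensive.

Import Order.TTheory GRing.Theory Num.Theory.

Local Open Scope ring_scope.

(* The library norm on matrices over a realType is the sup norm, hence this
   explicit Euclidean norm. *)
Definition enorm (R : realType) (n : nat) (v : 'cV[R]_n) : R :=
  Num.sqrt (\sum_(i < n) v i 0 ^+ 2).

(* The entry of the 1 x 1 matrix u^T M u. *)
Definition qform (R : realType) (n : nat) (M : 'M[R]_n) (u : 'cV[R]_n) : R :=
  (u^T *m M *m u) 0 0.

Definition sym_posdef (R : realType) (n : nat) (M : 'M[R]_n) : Prop :=
  M \is symmetricmx /\ forall x : 'cV[R]_n, x != 0 -> 0 < qform M x.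

(* A point of the real projective line is given by homogeneous coordinates
   p = (alpha_1, alpha_2) != (0, 0); [proj_eq p q] says that p and q represent
   the same point. *)
Definition proj_eq (R : realType) (p q : R * R) : Prop :=
  exists2 c : R, c != 0 & q = (c * p.1, c * p.2).

Definition homog_residual (R : realType) (n : nat) (A B : 'M[R]_n)
    (u : 'cV[R]_n) (p : R * R) : R :=
  enorm (p.1 *: (B *m u) - p.2 *: (A *m u)) / Num.sqrt (p.1 ^+ 2 + p.2 ^+ 2).

Definition proj_minimizer (R : realType) (f : R * R -> R) (p : R * R) : Prop :=
  p != (0, 0) /\ forall q : R * R, q != (0, 0) -> f p <= f q.

Definition unique_proj_minimizer (R : realType) (f : R * R -> R)
    (p : R * R) : Prop :=
  proj_minimizer f p /\ forall q : R * R, proj_minimizer f q -> proj_eq p q.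

(* The condition p.2 != 0 excludes the point at infinity, for which the
   quotient alpha_1 / alpha_2 is undefined. *)
Definition is_gen_homog_rayleigh (R : realType) (n : nat) (A B : 'M[R]_n)
    (u : 'cV[R]_n) (alpha : R) : Prop :=
  exists p : R * R,
    [/\ unique_proj_minimizer (homog_residual A B u) p,
        p.2 != 0 & alpha = p.1 / p.2].

(* Main.v *)
(** Put a = |Au|^2, b = |Bu|^2, m = <Au, Bu>.  If x is a root of
    m x^2 + (b - a) x - m with m x > 0, then completing the square gives
    |p1 Bu - p2 Au|^2 = (a - m x) (p1^2 + p2^2) + (m / x) (p1 - x p2)^2,
    so the residual is minimal exactly on the line p1 = x p2.  Hence the
    quotient equals every such root, and one exists by the quadratic formula. *)
Require Import Defs.
From mathcomp Require Import ring lra.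
Import Order.TTheory GRing.Theory Num.Theory.
Local Open Scope ring_scope.

Lemma symmetricmx_tr (R : realType) (n : nat) (M : 'M[R]_n) :
  M \is symmetricmx -> M^T = M.
Proof. by move=> /is_hermitianmxP {2}->; rewrite expr0 scale1r map_mx_id. Qed.

Lemma enorm_sqr (R : realType) (n : nat) (v : 'cV[R]_n) :
  enorm v ^+ 2 = (v^T *m v) 0 0.
Proof.
rewrite sqr_sqrtr ?sumr_ge0 // => [|i _]; last exact: sqr_ge0.
by rewrite mxE; apply: eq_bigr => i _; rewrite mxE expr2.
Qed.

Lemma sqr_add_gt0 (R : realType) (p : R * R) :
  p != (0, 0) -> 0 < p.1 ^+ 2 + p.2 ^+ 2.
Proof.
case: p => x y; rewrite xpair_eqE negb_and => /= xy0.
by rewrite lt0r paddr_eq0 ?sqr_ge0 // !sqrf_eq0 negb_and xy0 addr_ge0 ?sqr_ge0.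
Qed.

(** A 1 x 1 matrix equals its transpose, and transposing [u^T *m (A *m B) *m u] reverses the two
    symmetric factors. *)
Lemma qform_mulmxC (R : realType) (n : nat) (A B : 'M[R]_n) (u : 'cV[R]_n) :
  A \is symmetricmx -> B \is symmetricmx -> qform (B *m A) u = qform (A *m B) u.
Proof.
move=> hA hB; have As := symmetricmx_tr _ _ _ hA.
have Bs := symmetricmx_tr _ _ _ hB; rewrite /qform.
transitivity ((u^T *m (A *m B) *m u)^T 0 0); last by rewrite mxE.
by rewrite !trmx_mul trmxK As Bs !mulmxA.
Qed.

(** Symmetry turns each inner product of Au and Bu into a [qform], and the two cross terms merge by
    [qform_mulmxC]. *)
Lemma enorm_pencil_sqr (R : realType) (n : nat) (A B : 'M[R]_n)
    (u : 'cV[R]_n) (s t : R) :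
    A \is symmetricmx -> B \is symmetricmx ->
  enorm (s *: (B *m u) - t *: (A *m u)) ^+ 2 =
    qform (B *m B) u * s ^+ 2 - 2 * qform (A *m B) u * s * t
      + qform (A *m A) u * t ^+ 2.
Proof.
move=> hA hB; have BA := qform_mulmxC _ _ _ _ u hA hB.
have ip M N : M \is symmetricmx ->
    ((M *m u)^T *m (N *m u)) 0 0 = qform (M *m N) u.
  by move=> hM; rewrite trmx_mul symmetricmx_tr // /qform !mulmxA.
rewrite enorm_sqr [(_ - _)^T]linearB /= ![(_ *: _)^T]linearZ /=.
rewrite mulmxBl !mulmxBr -!scalemxAl -!scalemxAr.
have mxB (M N : 'M[R]_1) : (M - N) 0 0 = M 0 0 - N 0 0 by rewrite !mxE.
have mxZ c (M : 'M[R]_1) : (c *: M) 0 0 = c * M 0 0 by rewrite mxE.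
by rewrite !mxB !mxZ !ip // BA; ring.
Qed.

Lemma homog_residual_ge0 (R : realType) (n : nat) (A B : 'M[R]_n)
    (u : 'cV[R]_n) (p : R * R) : 0 <= homog_residual A B u p.
Proof. by rewrite divr_ge0 ?sqrtr_ge0. Qed.

Section PositiveRoot.

Variables (R : realType) (n : nat) (A B : 'M[R]_n) (u : 'cV[R]_n) (x : R).
Hypotheses (hA : A \is symmetricmx) (hB : B \is symmetricmx).
Hypothesis x_root : qform (A *m B) u * x ^+ 2
  + (qform (B *m B) u - qform (A *m A) u) * x - qform (A *m B) u = 0.
Hypothesis x_pos : 0 < x * qform (A *m B) u.

Let x_neq0 : x != 0.
Proof. by apply: contraTneq x_pos => ->; rewrite mul0r ltxx. Qed.

Let coef_gt0 : 0 < qform (A *m B) u / x.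
Proof.
have -> : qform (A *m B) u / x = x * qform (A *m B) u / x ^+ 2 by field.
by rewrite divr_gt0 // exprn_even_gt0.
Qed.

Lemma homog_residual_sqr (p : R * R) : p != (0, 0) ->
  homog_residual A B u p ^+ 2 =
    (qform (A *m A) u - qform (A *m B) u * x)
      + qform (A *m B) u / x * (p.1 - x * p.2) ^+ 2 / (p.1 ^+ 2 + p.2 ^+ 2).
Proof.
move=> /sqr_add_gt0 p_gt0; rewrite expr_div_n enorm_pencil_sqr //.
rewrite sqr_sqrtr ?ltW //.
(* The root equation divided by x, solved for b: b = a + m / x - m x. Once b is eliminated, the
   claim is an identity of rational functions. *)
have -> : qform (B *m B) u =
    qform (A *m A) u + qform (A *m B) u / x - qform (A *m B) u * x.
  apply: (mulIf x_neq0); rewrite /= mulrBl mulrDl divfK //.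
  by move: x_root; lra.
by field; rewrite x_neq0 gt_eqF.
Qed.

Lemma proj_minimizer_homog_residual (p : R * R) :
  proj_minimizer (homog_residual A B u) p <-> p != (0, 0) /\ p.1 = x * p.2.
Proof.
split=> [[p0 pmin]|[p0 px]]; split=> //; last move=> q q0.
  (* Compare p with (x, 1), where the square vanishes: minimality leaves (m / x) (p1 - x p2)^2 <= 0,
     and m / x > 0 forces p1 = x p2. *)
  have x0 : (x, 1) != (0, 0) :> R * R by rewrite xpair_eqE oner_eq0 andbF.
  move: (pmin _ x0).
  rewrite -ler_sqr ?nnegrE ?homog_residual_ge0 // !homog_residual_sqr //=.
  rewrite mulr1 subrr expr0n mulr0 mul0r lerD2l.
  rewrite pmulr_lle0 ?invr_gt0 ?sqr_add_gt0 // pmulr_rle0 //.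
  by rewrite exprn_even_le0 //= subr_eq0 => /eqP.
rewrite -ler_sqr ?nnegrE ?homog_residual_ge0 // !homog_residual_sqr //.
rewrite px subrr expr0n mulr0 mul0r lerD2l.
by rewrite divr_ge0 ?addr_ge0 ?sqr_ge0 // mulr_ge0 ?sqr_ge0 // ltW.
Qed.

(** The minimizers form the single projective point (x : 1). As x is any root with m x > 0, two such
    roots must both equal the quotient, hence each other. *)
Lemma is_gen_homog_rayleighE (alpha : R) :
  is_gen_homog_rayleigh A B u alpha <-> alpha = x.
Proof.
split=> [[p [[/proj_minimizer_homog_residual[_ px] _] p2 ->]]|->].
  by rewrite px mulfK.
exists (x, 1); split; rewrite ?oner_eq0 ?divr1 //; split.
  apply/proj_minimizer_homog_residual.
  by rewrite xpair_eqE oner_eq0 andbF mulr1.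
move=> [q1 q2] /proj_minimizer_homog_residual[/= q0 qx].
(* The scalar taking (x, 1) to (q1, q2) is q2; were it zero, q1 = x q2 would vanish too. *)
exists q2; last by rewrite /= mulr1 mulrC -qx.
by apply: contraNneq q0 => q20; rewrite qx q20 mulr0.
Qed.

End PositiveRoot.

Lemma positive_root_exists (R : realType) (m c : R) : m != 0 ->
  exists2 x : R, m * x ^+ 2 + c * x - m = 0 & 0 < x * m.
Proof.
move=> m0; set D := Num.sqrt (c ^+ 2 + 4 * m ^+ 2).
have m2 : 0 < m ^+ 2 by rewrite exprn_even_gt0.
have D2 : D ^+ 2 = c ^+ 2 + 4 * m ^+ 2.
  by rewrite sqr_sqrtr // addr_ge0 ?sqr_ge0 // mulr_ge0 // ltW.
have D0 : 0 <= D := sqrtr_ge0 _.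
(* The roots have product -1, hence opposite signs; the plus sign before the square root selects the
   one with the sign of m. *)
exists ((D - c) / (2 * m)).
  have -> : m * ((D - c) / (2 * m)) ^+ 2 + c * ((D - c) / (2 * m)) - m
      = (D ^+ 2 - c ^+ 2 - 4 * m ^+ 2) / (4 * m) by field.
  by rewrite D2; field.
have -> : (D - c) / (2 * m) * m = (D - c) / 2 by field.
(* D > c because D >= 0 and D^2 = c^2 + 4 m^2 > c^2. *)
by rewrite divr_gt0 // subr_gt0; nra.
Qed.

Theorem proposition7 (R : realType) (n : nat) (A B : 'M[R]_n) (u : 'cV[R]_n)
    (hA : A \is symmetricmx) (hB : sym_posdef B)
    (hu : qform (A *m B) u != 0) :
  (exists! alpha : R, is_gen_homog_rayleigh A B u alpha) /\
  forall alpha : R, is_gen_homog_rayleigh A B u alpha ->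
    [/\ qform (A *m B) u * alpha ^+ 2
          + (qform (B *m B) u - qform (A *m A) u) * alpha
          - qform (A *m B) u = 0,
        0 < alpha * qform (A *m B) u
      & forall x : R,
          qform (A *m B) u * x ^+ 2
            + (qform (B *m B) u - qform (A *m A) u) * x
            - qform (A *m B) u = 0 ->
          0 < x * qform (A *m B) u ->
          x = alpha].
Proof.
have [sB _] := hB.
have rayleighE := is_gen_homog_rayleighE _ _ _ _ u _ hA sB.
have [x x_root x_pos] :=
  positive_root_exists _ _ (qform (B *m B) u - qform (A *m A) u) hu.
split=> [|alpha /(rayleighE _ x_root x_pos) ->].
  exists x; split=> [|y /(rayleighE _ x_root x_pos) //].
  exact/(rayleighE _ x_root x_pos).
split=> // y y_root y_pos.
(* No algebra on the quadratic: x is the quotient by its own root property, so it equals y by that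
   of y. *)
by apply/esym/(rayleighE _ y_root y_pos)/(rayleighE _ x_root x_pos).
Qed.
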